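(* Let $n\ge 2$ and $m\ge 3$ be integers. Two forms $Q,\tilde Q\in X_n^m$ are linearly equivalent if and only if their associated forms $\mathbf{Q},\tilde{\mathbf{Q}}\in\mathcal{Q}_n^{n(m-2)}$ are linearly equivalent.
   Context: $\mathcal{Q}_n^m$ is the complex vector space of forms (homogeneous polynomials) of degree $m$ on $\mathbb{C}^n$. The discriminant $\Delta$ satisfies: for a form $Q$ of degree at least $2$, $\Delta(Q)\neq 0$ if and only if the first-order partial derivatives $Q_j:=\partial Q/\partial z_j$, $j=1,\dots,n$, have no common zero in $\mathbb{C}^n\setminus\{0\}$. For $m\ge 3$, $X_n^m:=\{Q\in\mathcal{Q}_n^m:\Delta(Q)\ne 0\}$. Associated form: for $Q\in X_n^m$ let $M(Q):=\mathbb{C}[z_1,\dots,z_n]/J(Q)$, where $J(Q)$ is the ideal generated by $Q_1,\dots,Q_n$ (the Milnor algebra). It is a local Artinian Gorenstein algebra; with $\mathfrak{m}$ its maximal ideal, $\mathrm{Soc}(M(Q)):=\{x\in\mathfrak{m}:x\mathfrak{m}=0\}$ is one-dimensional, equals $\mathfrak{m}^{n(m-2)}$, and is spanned by the element $e_0$ represented by the Hessian determinant $\mathrm{Hess}(Q)=\det(\partial^2Q/\partial z_i\partial z_j)$. Let $\omega:\mathrm{Soc}(M(Q))\to\mathbb{C}$ be the linear isomorphism with $\omega(e_0)=1$, and let $e_j$ be the element of $M(Q)$ represented by $z_j$. The associated form of $Q$ is $\mathbf{Q}\in\mathcal{Q}_n^{n(m-2)}$, $\mathbf{Q}(z):=\omega\left((z_1e_1+\dots+z_ne_n)^{n(m-2)}\right)$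 for $z=(z_1,\dots,z_n)\in\mathbb{C}^n$. $\mathrm{GL}(n,\mathbb{C})$ acts on forms by $(C,Q)\mapsto Q_C$, $Q_C(z):=Q(z(C^{-1})^T)$, with $z$ a row vector. Two forms are linearly equivalent if they lie in the same $\mathrm{GL}(n,\mathbb{C})$-orbit. *)

(* Defs.v *)
From HB Require Import structures.
From mathcomp Require Import all_boot all_order all_algebra.
From mathcomp Require Import boolp reals.
From mathcomp Require Import complex mpoly.

Set Implicit Arguments.
Unset Strict Implicit.
Unset Printing Implicit Defensive.

Import GRing.Theory.
Local Open Scope ring_scope.

(* A realType is a complete Archimedean ordered field, so R[i] is the field of
   complex numbers and {mpoly R[i][n]} is C[z_1, ..., z_n]. *)

(* The condition Delta(Q) != 0, for a form Q of degree at least 2: the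
   first-order partial derivatives have no common zero in C^n \ {0}. *)
Definition disc_neq0 (R : realType) (n : nat) (Q : {mpoly R[i][n]}) : Prop :=
  ~ exists z : 'rV[R[i]]_n,
      z != 0 /\ forall j : 'I_n, (Q^`M(j)).@[fun k => z 0 k] = 0.

(* X_n^m; like the set itself, this is only meant for m >= 3 and is empty for
   smaller m, so that 1 never lies in the Jacobian ideal. *)
Record Xform (R : realType) (n m : nat) := MkXform {
  Xpoly :> {mpoly R[i][n]};
  Xdeg : (3 <= m)%N;
  Xhomog : Xpoly \is m.-homog;
  Xdisc : disc_neq0 Xpoly
}.

Section MilnorAlgebra.
Variables (R : realType) (n m : nat).
Local Notation C := R[i].
Implicit Type Q : Xform R n m.

Definition jacobian_ideal Q : {pred {mpoly C[n]}} :=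
  fun p => `[< exists a : 'I_n -> {mpoly C[n]}, p = \sum_j a j * Q^`M(j) >].

Lemma jacobian_ideal_closed Q : idealr_closed (jacobian_ideal Q).
Proof.
split.
- apply/asboolP; exists (fun=> 0).
  by rewrite big1 // => j _; rewrite mul0r.
- apply/asboolP => -[a /(congr1 (mcoeff 0%MM))].
  rewrite mcoeff1 eqxx raddf_sum /= big1 => [|j _].
    by move/eqP; rewrite oner_eq0.
  rewrite rmorphM /= mcoeff_mderiv.
  suff -> : (Xpoly Q)@_(0 + U_(j)) = 0 by rewrite mul0rn mulr0.
  apply: (dhomog_nemf_coeff (Xhomog Q)).
  rewrite /= mdegD mdeg0 mdeg1; apply/eqP => m1.
  by have := Xdeg Q; rewrite -m1.
- move=> p u v /asboolP [a ->] /asboolP [b ->]; apply/asboolP.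
  exists (fun j => p * a j + b j).
  rewrite mulr_sumr -big_split /=; apply: eq_bigr => j _.
  by rewrite mulrDl mulrA.
Qed.

HB.instance Definition _ Q :=
  isIdealr.Build {mpoly C[n]} (jacobian_ideal Q) (jacobian_ideal_closed Q).

Definition milnor Q : Type := {ideal_quot (jacobian_ideal Q)}.
HB.instance Definition _ Q := GRing.ComNzRing.on (milnor Q).

Definition milnor_class Q (p : {mpoly C[n]}) : milnor Q :=
  (\pi_{ideal_quot (jacobian_ideal Q)} p)%qT.

Lemma milnor_class_is_zmod_morphism Q : zmod_morphism (@milnor_class Q).
Proof. by move=> p q; rewrite /milnor_class raddfB. Qed.

Lemma milnor_class_is_monoid_morphism Q : monoid_morphism (@milnor_class Q).
Proof. by split=> [|p q]; rewrite /milnor_class ?rmorph1 ?rmorphM. Qed.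

HB.instance Definition _ Q := GRing.isZmodMorphism.Build _ _
  (@milnor_class Q) (milnor_class_is_zmod_morphism Q).
HB.instance Definition _ Q := GRing.isMonoidMorphism.Build _ _
  (@milnor_class Q) (milnor_class_is_monoid_morphism Q).

Definition milnor_scale Q (c : C) (x : milnor Q) : milnor Q :=
  milnor_class Q c%:MP * x.

Lemma milnor_scaleA Q a b (x : milnor Q) :
  milnor_scale a (milnor_scale b x) = milnor_scale (a * b) x.
Proof. by rewrite /milnor_scale mulrA -rmorphM /= mpolyCM. Qed.

Lemma milnor_scale1 Q : left_id 1 (@milnor_scale Q).
Proof. by move=> x; rewrite /milnor_scale rmorph1 mul1r. Qed.

Lemma milnor_scaleDr Q : right_distributive (@milnor_scale Q) +%R.
Proof. by move=> a x y; rewrite /milnor_scale mulrDr. Qed.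

Lemma milnor_scaleDl Q (x : milnor Q) :
  {morph (@milnor_scale Q)^~ x : a b / a + b}.
Proof. by move=> a b; rewrite /milnor_scale mpolyCD rmorphD mulrDl. Qed.

HB.instance Definition _ Q := GRing.Zmodule_isLmodule.Build C (milnor Q)
  (@milnor_scaleA Q) (@milnor_scale1 Q) (@milnor_scaleDr Q)
  (@milnor_scaleDl Q).

(* The maximal ideal of a commutative local ring is the set of its
   non-invertible elements. *)
Definition maximal_ideal Q : {pred milnor Q} :=
  fun x => `[< ~ exists y : milnor Q, y * x = 1 >].
Arguments maximal_ideal Q : clear implicits.

Definition socle Q : {pred milnor Q} :=
  fun x => (x \in maximal_ideal Q) &&
           `[< forall y, y \in maximal_ideal Q -> x * y = 0 >].
Arguments socle Q : clear implicits.

Lemma socle_submod_closed Q : submod_closed (socle Q).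
Proof.
have m0 : (0 : milnor Q) \in maximal_ideal Q.
  by apply/asboolP => -[y]; rewrite mulr0 => /eqP; rewrite eq_sym oner_eq0.
split=> [|c x y /andP[xm /asboolP xs] /andP[ym /asboolP ys]].
  by apply/andP; split=> //; apply/asboolP => y _; rewrite mul0r.
have scE (u : milnor Q) : c *: u = milnor_class Q c%:MP * u by [].
have sm z : z \in maximal_ideal Q -> (c *: x + y) * z = 0.
  by move=> zm; rewrite mulrDl scE -mulrA xs // ys // mulr0 addr0.
apply/andP; split; last exact/asboolP.
apply/asboolP => -[u u1].
have k0 z : z \in maximal_ideal Q -> z = 0.
  by move=> zm; rewrite -[z]mul1r -u1 -mulrA sm // mulr0.
move: u1; rewrite (k0 x) // (k0 y) // scaler0 addr0 mulr0 => /eqP.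
by rewrite eq_sym oner_eq0.
Qed.

HB.instance Definition _ Q :=
  GRing.isSubmodClosed.Build C (milnor Q) (socle Q) (socle_submod_closed Q).

Record socle_type Q := MkSocle {
  socle_val :> milnor Q;
  socle_valP : socle_val \in socle Q
}.
HB.instance Definition _ Q := [isSub for @socle_val Q].
HB.instance Definition _ Q := [Choice of socle_type Q by <:].
HB.instance Definition _ Q := [SubChoice_isSubLmodule of socle_type Q by <:].

Definition hessian (Q : {mpoly C[n]}) : {mpoly C[n]} :=
  \det (\matrix_(i < n, j < n) Q^`M(i)^`M(j)).

(* F is the associated form of Q.  The isomorphism omega exists and is unique
   because the socle is the line spanned by the class of the Hessian and is the
   n(m-2)-th power of the maximal ideal; F is determined by its values. *)
Definition is_associated_form Q (F : {mpoly C[n]}) : Prop :=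
  F \is (n * (m - 2)).-homog /\
  exists omega : {linear socle_type Q -> C^o},
    [/\ bijective omega,
        (exists2 e0 : socle_type Q,
           socle_val e0 = milnor_class Q (hessian Q) & omega e0 = 1)
      & forall z : 'rV[C]_n,
          exists2 s : socle_type Q,
            socle_val s =
              (\sum_j z 0 j *: milnor_class Q 'X_j) ^+ (n * (m - 2))
            & F.@[fun j => z 0 j] = omega s].

End MilnorAlgebra.

Arguments maximal_ideal {R n m} Q _.
Arguments socle {R n m} Q _.

(* Q_A(z) = Q(z (A^-1)^T), z being the row vector ('X_1, ..., 'X_n). *)
Definition form_act (R : realType) (n : nat) (A : 'M[R[i]]_n)
    (Q : {mpoly R[i][n]}) : {mpoly R[i][n]} :=
  Q \mPo [tuple ((\row_k 'X_k : 'rV[{mpoly R[i][n]}]_n)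
                 *m map_mx (@mpolyC n R[i]) (invmx A)^T) 0 j | j < n].

Definition linearly_equivalent (R : realType) (n : nat)
    (P Q : {mpoly R[i][n]}) : Prop :=
  exists2 A : 'M[R[i]]_n, A \in unitmx & Q = form_act A P.

(* Main.v *)
From HB Require Import structures.
Require Import Defs.
From mathcomp Require Import all_boot all_order all_algebra.
From mathcomp Require Import boolp reals.
From mathcomp Require Import complex mpoly.
From mathcomp Require Import zify ring.

(* Write J(Q) for the Jacobian ideal and N = n(m-2). If Q' = Q o B, the
   substitution B maps J(Q) into J(Q') and Hess(Q) to a scalar multiple of
   Hess(Q'), so F' composed with a linear map is a scalar multiple of F, and the
   scalar is an N-th power.

   Conversely, modulo J(Q) every form of degree N is a multiple of Hess(Q), and
   F records this multiple because powers of linear forms span. As the socle is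
   a line in degree N, a form p of degree d <= N lies in J(Q) if and only if all
   products pq with deg q = N - d do; so F determines J(Q) in degrees up to N.
   If F ~ F', a linear substitution psi therefore maps J(Q') into J(Q), and
   comparing elements of degree m-1 gives grad(psi Q') = M grad(Q) with M a
   constant invertible matrix. Since Hessians are symmetric, M is self-adjoint
   for the symmetric m-linear form of Q, and so is a polynomial S in M with
   S^m = M. Hence m Q(zS) = z S^m grad(Q) = z grad(psi Q') = m (psi Q')(z). *)

Set Implicit Arguments.
Unset Strict Implicit.
Unset Printing Implicit Defensive.

Import GRing.Theory Num.Theory.
Local Open Scope ring_scope.

(** * Polynomials over a field of characteristic zero *)

Lemma mpoly_ring_ind (K : comNzRingType) (n : nat) (P : {mpoly K[n]} -> Prop) :
  (forall c, P c%:MP) -> (forall i, P 'X_i) ->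
  (forall p q, P p -> P q -> P (p + q)) ->
  (forall p q, P p -> P q -> P (p * q)) ->
  forall p, P p.
Proof.
move=> PC PX PD PM p; rewrite [p]mpolyE.
elim/big_ind: _ => [|q r Pq Pr|a _]; first by rewrite -mpolyC0.
  exact: PD.
rewrite -mul_mpolyC mpolyXE_id; apply: (PM _ _ (PC _)).
elim/big_ind: _ => [|q r Pq Pr|i _]; first by rewrite -mpolyC1.
  exact: PM.
elim: (a i) => [|k IH]; first by rewrite expr0 -mpolyC1.
by rewrite exprS; apply: PM.
Qed.

Lemma mderivXU (K : comNzRingType) (n : nat) (i j : 'I_n) :
  ('X_j : {mpoly K[n]})^`M(i) = (i == j)%:R.
Proof.
rewrite mderivX mnm1E eq_sym; have [->|_] := eqVneq; last by rewrite scale0r.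
by rewrite scale1r -mpolyX0 -{1}[U_(_)%MM]add0m addmK.
Qed.

(** Chain rule: in [p], both sides obey the Leibniz rule over [f], vanish on constants and agree on
    the variables. It serves both for [deriv] along a line and for [mderiv] after a linear
    substitution. *)
Lemma derivation_mpoly (K : comNzRingType) (n : nat) (A : comNzRingType)
    (f : {rmorphism {mpoly K[n]} -> A}) (D : {additive A -> A}) :
  (forall a b, D (a * b) = D a * b + a * D b) ->
  (forall c, D (f c%:MP) = 0) ->
  forall p, D (f p) = \sum_i f p^`M(i) * D (f 'X_i).
Proof.
move=> DM DC; apply: mpoly_ring_ind => [c|j|p q IHp IHq|p q IHp IHq].
- by rewrite DC big1 // => i _; rewrite mderivC rmorph0 mul0r.
- rewrite (bigD1 j) //= mderivXU eqxx rmorph1 mul1r big1 ?addr0 // => i ij.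
  by rewrite mderivXU (negPf ij) rmorph0 mul0r.
- rewrite rmorphD raddfD IHp IHq -big_split /=; apply: eq_bigr => i _.
  by rewrite mderivD rmorphD mulrDl.
- rewrite rmorphM DM IHp IHq mulr_suml mulr_sumr -big_split /=.
  apply: eq_bigr => i _; rewrite mderivM rmorphD !rmorphM mulrDl.
  by rewrite mulrAC mulrA.
Qed.

Lemma dhomog_mderiv (K : comNzRingType) (n d : nat) (p : {mpoly K[n]}) i :
  p \is d.+1.-homog -> p^`M(i) \is d.-homog.
Proof.
move=> hp; apply/dhomogP => a; rewrite mcoeff_msupp mcoeff_mderiv => nz.
have: p@_(a + U_(i)) != 0 by apply: contraNneq nz => ->; rewrite mul0rn.
rewrite -mcoeff_msupp => /(dhomog_mf hp) /=.
by rewrite mdegD mdeg1 addn1 => -[].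
Qed.

Lemma dhomog0_const (K : comNzRingType) (n : nat) (p : {mpoly K[n]}) :
  p \is 0.-homog -> p = (p@_0)%:MP.
Proof.
move=> hp; apply/mpolyP => a; rewrite mcoeffC.
have [->|a0] := eqVneq a 0%MM; first by rewrite mulr1.
by rewrite mulr0; apply: (dhomog_nemf_coeff hp); rewrite mdeg_eq0.
Qed.

Lemma dhomogXU (K : comNzRingType) (n : nat) (i : 'I_n) :
  ('X_i : {mpoly K[n]}) \is 1.-homog.
Proof. by rewrite dhomogX /= mdeg1. Qed.

Lemma euler_formula (K : comNzRingType) (n d : nat) (p : {mpoly K[n]}) :
  p \is d.-homog -> \sum_i 'X_i * p^`M(i) = p *+ d.
Proof.
move=> hp; rewrite {2}[p]mpolyE -sumrMnl.
under eq_bigr => i _ do rewrite {1}[p]mpolyE linear_sum /= mulr_sumr.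
rewrite exchange_big /= !big_seq; apply: eq_bigr => a ap.
rewrite -(dhomog_mf hp ap) /= mdegE -sumrMnr; apply: eq_bigr => i _.
rewrite mderivZ mderivX scalerA -scalerAr -mpolyXD.
have [a0|a0] := eqVneq (a i) 0%N; first by rewrite a0 mulr0 mulr0n scale0r.
by rewrite addmC submK ?lep1mP // mulr_natr scalerMnl.
Qed.

(* Replacing f(t) by f(2t) - 2^d f(t) kills the top coefficient. *)
Lemma coef_mem_of_values (K : numFieldType) (V : lmodType K) (S : V -> Prop) :
  S 0 -> (forall a u v, S u -> S v -> S (a *: u + v)) ->
  forall (d : nat) (v : nat -> V),
    (forall t : K, S (\sum_(k < d) t ^+ k *: v k)) ->
  forall k, (k < d)%N -> S (v k).
Proof.
move=> S0 Slin; elim=> [//|d IH] v Sv.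
have low k : (k < d)%N -> S (v k).
  move=> kd; have c0 : (2 ^+ k - 2 ^+ d : K) != 0.
    by rewrite subr_eq0 -!natrX eqr_nat eqn_exp2l // ltn_eqF.
  suff: S ((2 ^+ k - 2 ^+ d) *: v k).
    move=> /(Slin (2 ^+ k - 2 ^+ d)^-1 _ 0) /(_ S0).
    by rewrite addr0 scalerA mulVf // scale1r.
  apply: (IH (fun k => (2 ^+ k - 2 ^+ d) *: v k)) => // t.
  have := Slin (- 2 ^+ d) _ _ (Sv t) (Sv (2 * t)).
  rewrite !big_ord_recr /= scalerDr addrACA scalerA exprMn.
  rewrite -scalerDl mulNr addNr scale0r addr0 scaler_sumr -big_split /=.
  congr S; apply: eq_bigr => i _; rewrite !scalerA -scalerDl exprMn mulNr addrC.
  by rewrite -mulrBl mulrC.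
move=> k; rewrite ltnS leq_eqVlt => /predU1P[->|/low//].
have Ssum : S (\sum_(i < d) v i).
  elim/big_ind: _ => // [x y Sx Sy|i _]; last exact: low.
  by rewrite -[x]scale1r; apply: Slin.
have := Slin (-1) _ _ Ssum (Sv 1); rewrite big_ord_recr /= expr1n scale1r.
under [in X in S (_ + (X + _))]eq_bigr => i _ do rewrite expr1n scale1r.
by rewrite scaleN1r addKr.
Qed.

Definition lform (K : nzRingType) (n : nat) (z : 'rV[K]_n) : {mpoly K[n]} :=
  \sum_j z 0 j *: 'X_j.

Lemma lformDZ (K : nzRingType) (n : nat) (a : K) (z w : 'rV[K]_n) :
  lform (z + a *: w) = lform z + a *: lform w.
Proof.
rewrite /lform scaler_sumr -big_split /=; apply: eq_bigr => j _.
by rewrite !mxE scalerDl scalerA.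
Qed.

Lemma lform_delta (K : nzRingType) (n : nat) (i : 'I_n) :
  lform (delta_mx 0 i : 'rV[K]_n) = 'X_i.
Proof.
rewrite /lform (bigD1 i) //= mxE !eqxx scale1r big1 ?addr0 // => j ji.
by rewrite mxE (negPf ji) andbF scale0r.
Qed.

(** Polarisation, by induction on [d]. The factor [r] lets the induction absorb one variable at a
    time; it also gives access to degree N+1, where the known elements of J are N-th powers times a
    variable. *)
Lemma lform_powers_mul_span (K : numFieldType) (n : nat)
    (S : {mpoly K[n]} -> Prop) :
  S 0 -> (forall a u v, S u -> S v -> S (a *: u + v)) ->
  forall (d : nat) (r : {mpoly K[n]}),
    (forall z, S (lform z ^+ d * r)) ->
  forall q, q \is d.-homog -> S (q * r).
Proof.
move=> S0 Slin.
have SZ a u : S u -> S (a *: u) by move=> /(Slin a) /(_ S0); rewrite addr0.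
have SD u v : S u -> S v -> S (u + v) by rewrite -{2}[u]scale1r; apply: Slin.
elim=> [|d IH] r Sr q hq.
  rewrite (dhomog0_const hq) mul_mpolyC; apply: SZ.
  by have := Sr 0; rewrite expr0 mul1r.
have d0 : (d.+1%:R : K) != 0 by rewrite pnatr_eq0.
have SX i z : S (lform z ^+ d * ('X_i * r)).
  (* [v k] is the coefficient of t^k in ([lform z] + t X_i)^(d+1) r; the coefficient of t is d+1
     times the wanted product. *)
  pose v k := (lform z ^+ (d.+1 - k) * 'X_i ^+ k *+ 'C(d.+1, k)) * r.
  have Sv t : S (\sum_(k < d.+2) t ^+ k *: v k).
    have := Sr (z + t *: delta_mx 0 i); rewrite lformDZ lform_delta exprDn.
    rewrite mulr_suml; congr S; apply: eq_bigr => k _.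
    by rewrite exprZn -scalerAr scalerMnr -scalerAl.
  have := coef_mem_of_values S0 Slin Sv (isT : (1 < d.+2)%N).
  rewrite /v subSS subn0 expr1 bin1 -mulrnAl -mulr_natl -mulrA -mulrA.
  rewrite -mpolyC_nat mul_mpolyC => /(SZ d.+1%:R^-1).
  by rewrite scalerA mulVf // scale1r.
rewrite -[q * r]scale1r -(mulVf d0) -scalerA; apply: SZ.
rewrite scaler_nat -mulrnAl -(euler_formula hq) mulr_suml.
elim/big_ind: _ => // i _; rewrite mulrAC mulrC.
exact: (IH _ (SX i) _ (dhomog_mderiv i hq)).
Qed.

Lemma lform_powers_span (K : numFieldType) (n d : nat)
    (S : {mpoly K[n]} -> Prop) :
  S 0 -> (forall a u v, S u -> S v -> S (a *: u + v)) ->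
  (forall z, S (lform z ^+ d)) -> forall q, q \is d.-homog -> S q.
Proof.
move=> S0 Slin Spow q hq; rewrite -[q]mulr1.
by apply: lform_powers_mul_span hq => // z; rewrite mulr1.
Qed.

Lemma mulrn_char0_inj (K : numFieldType) (n d : nat) (p q : {mpoly K[n]}) :
  (0 < d)%N -> p *+ d = q *+ d -> p = q.
Proof.
move=> d0 /eqP; rewrite -subr_eq0 -mulrnBl -mulr_natl -mpolyC_nat mul_mpolyC.
by rewrite mscalerI pnatr_eq0 gtn_eqF //= subr_eq0 => /eqP.
Qed.

(** Induction on the degree: the partials again vanish at every point, hence are zero, and Euler's
    formula recovers [p] from them. *)
Lemma dhomog_meval_eq0 (K : numFieldType) (n d : nat) (p : {mpoly K[n]}) :
  p \is d.-homog -> (forall z : 'rV[K]_n, p.@[fun j => z 0 j] = 0) -> p = 0.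
Proof.
elim: d p => [|d IH] p hp p0.
  have := p0 0; rewrite (dhomog0_const hp) mevalC => ->; exact: mpolyC0.
have dp i : p^`M(i) = 0.
  apply: IH => [|z]; first exact: dhomog_mderiv.
  (* Restriction to the line z + t e_i: a polynomial in t whose values are all zero, so it is zero,
     and its derivative at t = 0 is the i-th partial at z. *)
  pose h (k : 'I_n) : {poly K} := (z 0 k)%:P + (k == i)%:R *: 'X.
  have ev (q : {mpoly K[n]}) t :
      (mmap polyC h q).[t] = q.@[fun k => z 0 k + (k == i)%:R * t].
    move: q; apply: mpoly_ring_ind => [c|j|q r IHq IHr|q r IHq IHr].
    - by rewrite mmapC mevalC hornerC.
    - by rewrite mmapX mmap1U mevalXU !hornerE.
    - by rewrite rmorphD mevalD hornerD IHq IHr.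
    - by rewrite rmorphM mevalM hornerM IHq IHr.
  have g0 : mmap polyC h p = 0.
    apply/polyP => k; rewrite coef0.
    have [|/leq_sizeP->//] := ltnP k (size (mmap polyC h p)).
    apply: (@coef_mem_of_values K K^o (fun x => x = 0)) => // [a u v ->->|t].
      by rewrite scaler0 addr0.
    under eq_bigr => j _ do rewrite [_ *: _]mulrC.
    rewrite -horner_coef ev -[RHS](p0 (z + t *: delta_mx 0 i)).
    by apply: meval_eq => j; rewrite !mxE eqxx /= mulrC.
  have DC c : (mmap polyC h c%:MP)^`() = 0 by rewrite mmapC derivC.
  have /= := @derivation_mpoly K n _ (mmap polyC h) (@deriv K) (@derivM _) DC p.
  rewrite g0 deriv0 (bigD1 i) //= big1 => [|j ji]; last first.
    by rewrite mmapX mmap1U /h (negPf ji) scale0r addr0 derivC mulr0.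
  rewrite mmapX mmap1U /h eqxx scale1r derivD derivC derivX add0r mulr1 addr0.
  move/(congr1 (horner^~ 0)); rewrite ev horner0 => /esym <-.
  by apply: meval_eq => j; rewrite mulr0 addr0.
apply: (@mulrn_char0_inj _ _ d.+1) => //.
by rewrite -(euler_formula hp) mul0rn big1 // => i _; rewrite dp mulr0.
Qed.

(** * Linear substitutions *)

(** For invertible [B] this is the action of its inverse. Row j of [B] is the image of X_j, so
    linear forms transform by z B but points by z B^T; hence the transposes below. *)
Definition lin_subst (K : comNzRingType) (n : nat) (B : 'M[K]_n)
    (p : {mpoly K[n]}) : {mpoly K[n]} :=
  p \mPo [tuple \sum_k B j k *: 'X_k | j < n].

HB.instance Definition _ (K : comNzRingType) (n : nat) (B : 'M[K]_n) :=
  GRing.RMorphism.copy (lin_subst B)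
    (comp_mpoly [tuple \sum_k B j k *: 'X_k | j < n]).

Local Notation "A %:CM" := (map_mx (@mpolyC _ _) A)
  (at level 2, left associativity, format "A %:CM").

Definition mvars (K : comNzRingType) (n : nat) : 'rV[{mpoly K[n]}]_n :=
  \row_k 'X_k.

Definition grad (K : comNzRingType) (n : nat) (p : {mpoly K[n]}) :
  'cV[{mpoly K[n]}]_n := \col_j p^`M(j).

Definition hess_mx (K : comNzRingType) (n : nat) (p : {mpoly K[n]}) :
  'M[{mpoly K[n]}]_n := \matrix_(i, j) p^`M(i)^`M(j).

Section LinSubst.
Variables (K : comNzRingType) (n : nat).
Implicit Types (A B : 'M[K]_n) (p : {mpoly K[n]}).

Lemma lin_substX B j : lin_subst B 'X_j = \sum_k B j k *: 'X_k.
Proof. by rewrite /lin_subst comp_mpolyXU -tnth_nth tnth_mktuple. Qed.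

Lemma lin_substC B c : lin_subst B c%:MP = c%:MP.
Proof. exact: comp_mpolyC. Qed.

Lemma lin_substZ B c p : lin_subst B (c *: p) = c *: lin_subst B p.
Proof. exact: comp_mpolyZ. Qed.

Lemma lin_subst_comp A B p :
  lin_subst A (lin_subst B p) = lin_subst (B *m A) p.
Proof.
move: p; apply: mpoly_ring_ind => [c|j|p q IHp IHq|p q IHp IHq].
- by rewrite !lin_substC.
- rewrite !lin_substX rmorph_sum /=.
  under eq_bigr => k _ do rewrite lin_substZ lin_substX scaler_sumr.
  rewrite exchange_big /=; apply: eq_bigr => l _.
  by rewrite mxE scaler_suml; apply: eq_bigr => k _; rewrite scalerA.
- by rewrite !rmorphD /= IHp IHq.
- by rewrite !rmorphM /= IHp IHq.
Qed.

Lemma lin_subst1 p : lin_subst 1%:M p = p.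
Proof.
rewrite -[RHS]comp_mpoly_id; congr comp_mpoly; apply: eq_mktuple => j.
rewrite (bigD1 j) //= mxE eqxx scale1r big1 ?addr0 // => k kj.
by rewrite mxE eq_sym (negPf kj) scale0r.
Qed.

Lemma meval_lin_subst B p (z : 'rV[K]_n) :
  (lin_subst B p).@[fun j => z 0 j] = p.@[fun j => (z *m B^T) 0 j].
Proof.
rewrite comp_mpoly_meval; apply: meval_eq => j.
rewrite tnth_mktuple raddf_sum mxE /=; apply: eq_bigr => k _.
by rewrite mevalZ mevalXU mxE mulrC.
Qed.

Lemma lin_subst_lform B z : lin_subst B (lform z) = lform (z *m B).
Proof.
rewrite /lform rmorph_sum /=.
under eq_bigr => j _ do rewrite lin_substZ lin_substX scaler_sumr.
rewrite exchange_big /=; apply: eq_bigr => k _.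
by rewrite mxE scaler_suml; apply: eq_bigr => j _; rewrite scalerA.
Qed.

Lemma dhomog_lin_subst B p d :
  p \is d.-homog -> lin_subst B p \is d.-homog.
Proof.
move=> hp; rewrite [p]mpolyE rmorph_sum /= big_seq.
apply: rpred_sum => a ap; rewrite lin_substZ; apply: rpredZ.
rewrite /lin_subst comp_mpolyX -(dhomog_mf hp ap) /= mdegE.
apply: (big_ind2 (fun (q : {mpoly K[n]}) (e : nat) => q \is e.-homog)).
- exact: dhomog1.
- by move=> q e r f; apply: dhomogM.
move=> j _; rewrite tnth_mktuple -{2}[a j]mul1n; apply: dhomogMn.
by apply: rpred_sum => k _; apply/rpredZ/dhomogXU.
Qed.

Lemma mderiv_lin_subst B p i :
  (lin_subst B p)^`M(i) = \sum_j B j i *: lin_subst B p^`M(j).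
Proof.
have DC c : (lin_subst B c%:MP)^`M(i) = 0 by rewrite lin_substC mderivC.
rewrite (@derivation_mpoly K n _ (lin_subst B) (@mderiv n K i)
  (@mderivM _ _ i) DC).
apply: eq_bigr => j _ /=; rewrite lin_substX linear_sum /= (bigD1 i) //=.
rewrite mderivZ mderivXU eqxx big1 => [|k ki].
  by rewrite addr0 -mul_mpolyC mulr1 mulrC mul_mpolyC.
by rewrite mderivZ mderivXU eq_sym (negPf ki) scaler0.
Qed.

Lemma grad_lin_subst B p :
  grad (lin_subst B p) = B^T%:CM *m map_mx (lin_subst B) (grad p).
Proof.
apply/matrixP => i j; rewrite !mxE mderiv_lin_subst; apply: eq_bigr => k _.
by rewrite !mxE mul_mpolyC.
Qed.

Lemma hess_lin_subst B p :
  hess_mx (lin_subst B p) =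
    B^T%:CM *m map_mx (lin_subst B) (hess_mx p) *m B%:CM.
Proof.
apply/matrixP => i j; rewrite !mxE mderiv_lin_subst linear_sum /=.
under eq_bigr => k _ do rewrite mderivZ mderiv_lin_subst scaler_sumr.
rewrite exchange_big /=; apply: eq_bigr => l _; rewrite !mxE mulr_suml.
apply: eq_bigr => k _; rewrite !mxE mulrC !mul_mpolyC !scalerA.
by rewrite mulrC.
Qed.

Lemma hess_mxT p : (hess_mx p)^T = hess_mx p.
Proof. by apply/matrixP => i j; rewrite !mxE mderiv_comm. Qed.

Lemma euler_grad d p : p \is d.-homog -> mvars K n *m grad p = (p *+ d)%:M.
Proof.
move=> hp; apply/matrixP => i j; rewrite !ord1 !mxE -(euler_formula hp) mulr1n.
by apply: eq_bigr => k _; rewrite !mxE.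
Qed.

Lemma euler_hess d p :
  p \is d.+1.-homog -> mvars K n *m hess_mx p = (grad p)^T *+ d.
Proof.
move=> hp; apply/rowP => j; rewrite mulmxnE !mxE.
rewrite -(euler_formula (dhomog_mderiv j hp)).
by apply: eq_bigr => k _; rewrite !mxE mderiv_comm.
Qed.

End LinSubst.

(** * Self-adjoint matrices *)

Section SelfAdjoint.
Variables (K : comNzRingType) (n : nat).
Implicit Types (A B : 'M[K]_n.+1) (H : 'M[{mpoly K[n.+1]}]_n.+1).

(** On row vectors this says (u A) H v^T = u H (v A)^T, for a bilinear form with polynomial
    coefficients and a constant matrix [A]. *)
Definition self_adjoint H A := A%:CM *m H = H *m A^T%:CM.

Lemma self_adjoint_scalar H c : self_adjoint H c%:M.
Proof. by rewrite /self_adjoint tr_scalar_mx map_scalar_mx scalar_mxC. Qed.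

Lemma self_adjointD H A B :
  self_adjoint H A -> self_adjoint H B -> self_adjoint H (A + B).
Proof.
move=> hA hB; rewrite /self_adjoint linearD /= !map_mxD.
by rewrite mulmxDl mulmxDr hA hB.
Qed.

Lemma self_adjointM H A B : GRing.comm A B ->
  self_adjoint H A -> self_adjoint H B -> self_adjoint H (A *m B).
Proof.
move=> AB hA hB; rewrite /self_adjoint map_mxM -mulmxA hB mulmxA hA.
by rewrite -mulmxA -map_mxM -trmx_mul (AB : A *m B = B *m A).
Qed.

Lemma self_adjointX H A d : self_adjoint H A -> self_adjoint H (A ^+ d).
Proof.
move=> hA; elim: d => [|d IH]; first exact: self_adjoint_scalar.
by rewrite exprS; apply: self_adjointM => //; apply: commrX.
Qed.

Lemma self_adjoint_horner H A (q : {poly K}) :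
  self_adjoint H A -> self_adjoint H (horner_mx A q).
Proof.
move=> hA; elim/poly_ind: q => [|q c IH].
  by rewrite rmorph0 -(raddf0 (@scalar_mx K n.+1)); apply: self_adjoint_scalar.
rewrite rmorphD rmorphM /= horner_mx_X horner_mx_C.
apply: self_adjointD; last exact: self_adjoint_scalar.
by apply: self_adjointM => //; apply/commr_sym/comm_mx_horner.
Qed.

End SelfAdjoint.

Lemma hess_mx_mderiv (K : comNzRingType) (n : nat) (p : {mpoly K[n]}) l :
  hess_mx p^`M(l) = map_mx (mderiv l) (hess_mx p).
Proof.
apply/matrixP => i j; rewrite !mxE.
by rewrite (mderiv_comm l i) (mderiv_comm l j).
Qed.

(** As [A] is constant, the identity may be differentiated entrywise. This allows induction on the
    degree through the partials. *)
Lemma self_adjoint_mderiv (K : comNzRingType) (n : nat) (p : {mpoly K[n.+1]})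
    (A : 'M_n.+1) l :
  self_adjoint (hess_mx p) A -> self_adjoint (hess_mx p^`M(l)) A.
Proof.
move=> hA; rewrite /self_adjoint hess_mx_mderiv.
transitivity (map_mx (mderiv l) (A%:CM *m hess_mx p)).
  apply/matrixP => i j; rewrite !mxE linear_sum /=; apply: eq_bigr => k _.
  by rewrite !mxE mderiv_mulC.
rewrite hA; apply/matrixP => i j; rewrite !mxE linear_sum /=.
by apply: eq_bigr => k _; rewrite !mxE mulrC mderiv_mulC mulrC.
Qed.

(* If f is the symmetric d-linear form with p(z) = f(z, ..., z), a self-adjoint
   A moves freely between the arguments, so p(z A) = f(z A^d, z, ..., z). *)
Lemma self_adjoint_lin_subst (K : numFieldType) (n d : nat)
    (p : {mpoly K[n.+1]}) (A : 'M[K]_n.+1) :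
  p \is d.-homog -> self_adjoint (hess_mx p) A ->
  (lin_subst A^T p *+ d)%:M = mvars K n.+1 *m (A ^+ d)%:CM *m grad p.
Proof.
elim: d p => [|d IH] p hp hA.
  rewrite mulr0n (dhomog0_const hp); apply/matrixP => i j.
  rewrite !ord1 !mxE mul0rn big1 // => k _.
  by rewrite [X in _ * X]mxE mderivC mulr0.
(* Apply the induction hypothesis to each partial, move the power of [A] across the Hessian, and use
   Euler's formula for the gradient. *)
have gradA : map_mx (lin_subst A^T) (grad p) = (A ^+ d)%:CM *m grad p.
  apply/matrixP => l j; rewrite ord1 {j} mxE [in LHS]mxE.
  have hl := dhomog_mderiv l hp.
  (* When [p] is linear the induction hypothesis carries the factor 0 and says nothing; the partials
     are then constants. *)
  case: d IH hp hl => [_ _ hl|d IH hp hl].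
    by rewrite map_mx1 mul1mx mxE (dhomog0_const hl) lin_substC.
  apply: (@mulrn_char0_inj _ _ d.+1) => //.
  have := IH _ hl (self_adjoint_mderiv l hA).
  have -> : grad p^`M(l) = col l (hess_mx p).
    by apply/matrixP => i j; rewrite !mxE mderiv_comm.
  rewrite colE mulmxA -colE -mulmxA (self_adjointX d.+1 hA) mulmxA.
  rewrite (euler_hess hp).
  move/matrixP/(_ 0 0); rewrite !mxE mulr1n => ->.
  rewrite -sumrMnl; apply: eq_bigr => k _.
  by rewrite mulmxnE !mxE mulrnAl mulrC.
have /(congr1 (map_mx (lin_subst A^T))) := euler_grad hp.
rewrite map_mxM map_scalar_mx raddfMn /= => <-.
have -> : map_mx (lin_subst A^T) (mvars K n.+1) = mvars K n.+1 *m A%:CM.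
  apply/rowP => j; rewrite !mxE lin_substX.
  by apply: eq_bigr => k _; rewrite !mxE mulrC mul_mpolyC.
by rewrite gradA mulmxA (exprS A d : _ = A *m A ^+ d) map_mxM mulmxA.
Qed.

(** * Roots of matrices *)

(* Adding a root a to f, replace q by q + c f: if f(a) != 0 choose c so that
   q(a) + c f(a) is a root of a, otherwise solve the linearised equation. *)
Lemma poly_root_modulo (K : numClosedFieldType) (d : nat) (s : seq K) :
  (0 < d)%N -> 0 \notin s ->
  exists q : {poly K}, \prod_(a <- s) ('X - a%:P) %| q ^+ d - 'X.
Proof.
move=> d0; elim: s => [|a s IH]; first by exists 0; rewrite big_nil dvd1p.
rewrite inE eq_sym negb_or => /andP[a0 /IH[q]].
rewrite big_cons; set f := \prod_(b <- s) _ => /dvdpP[u qE].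
(* [w c] is the quotient of (q + c f)^d - X by f, by the factorisation of a difference of d-th
   powers. It remains to make it vanish at a. *)
pose w c := u + c%:P * \sum_(i < d) (q + c%:P * f) ^+ (d.-1 - i) * q ^+ i.
have wE c : (q + c%:P * f) ^+ d - 'X = w c * f.
  rewrite -(subrK (q ^+ d) (_ ^+ d)) -addrA qE subrXX addrAC subrr add0r.
  rewrite /w mulrDl addrC; congr (_ + _).
  by rewrite mulrAC; congr (_ * _ * _).
suff [c wa] : exists c, root (w c) a.
  by exists (q + c%:P * f); rewrite wE dvdp_mul // dvdp_XsubCl.
have [fa|fa] := eqVneq f.[a] 0.
  (* Here q(a)^d = a is nonzero, so the equation, which is affine in c, has nonzero slope d
     q(a)^(d-1). *)
  have qa0 : q.[a] != 0.
    have /(congr1 (horner^~ a)) := qE; rewrite !hornerE fa mulr0.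
    move/eqP; rewrite subr_eq0; apply: contraTneq => ->.
    by rewrite expr0n gtn_eqF // eq_sym.
  pose e := d%:R * q.[a] ^+ d.-1.
  have e0 : e != 0 by rewrite mulf_neq0 ?pnatr_eq0 ?gtn_eqF ?expf_neq0.
  exists (- u.[a] / e); rewrite /root /w !hornerE horner_sum.
  rewrite (eq_bigr (fun=> q.[a] ^+ d.-1)) => [|i _].
    by rewrite sumr_const card_ord -mulr_natl -/e divfK // addrN.
  rewrite !hornerE fa mulr0 addr0 -exprD.
  by rewrite subnK // -ltnS prednK.
have [b ba] : exists b : K, b ^+ d = a by exists (d.-root a); apply: rootCK.
exists ((b - q.[a]) / f.[a]); rewrite /root.
rewrite -(inj_eq (mulIf fa)) mul0r -hornerM -wE !hornerE.
by rewrite divfK // [q.[a] + _]addrC subrK ba subrr.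
Qed.

(** Take the eigenvalues with multiplicity: q^d - X is then a multiple of the characteristic
    polynomial, and Cayley-Hamilton applies. A root that is a polynomial in [M] inherits
    self-adjointness. *)
Lemma mx_root (K : numClosedFieldType) (n d : nat) (M : 'M[K]_n.+1) :
  (0 < d)%N -> M \in unitmx ->
  exists q : {poly K}, horner_mx M q ^+ d = M.
Proof.
move=> d0 uM; have [s sE] := closed_field_poly_normal (char_poly M).
move: sE; rewrite (monicP (char_poly_monic M)) scale1r => sE.
have s0 : 0 \notin s.
  rewrite -root_prod_XsubC -sE rootE horner_coef0 char_poly_det.
  by rewrite mulf_neq0 ?signr_eq0 // -unitfE -unitmxE.
have [q] := poly_root_modulo d0 s0; rewrite -sE => /dvdpP[u qE]; exists q.
apply/eqP; rewrite -subr_eq0 -{2}(horner_mx_X M) -rmorphXn -rmorphB /= qE.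
by rewrite rmorphM /= Cayley_Hamilton mulr0.
Qed.

Lemma lin_subst_of_grad (K : numClosedFieldType) (n d : nat)
    (p q : {mpoly K[n.+1]}) (M : 'M[K]_n.+1) :
  (0 < d)%N -> p \is d.-homog -> q \is d.-homog -> M \in unitmx ->
  grad q = M%:CM *m grad p ->
  exists2 S : 'M[K]_n.+1, S \in unitmx & q = lin_subst S p.
Proof.
move=> d0 hp hq uM qM.
have hM : hess_mx q = M%:CM *m hess_mx p.
  apply/matrixP => i j; move/matrixP/(_ i 0): qM; rewrite !mxE => ->.
  rewrite linear_sum /=; apply: eq_bigr => k _.
  by rewrite !mxE mderiv_mulC.
have aM : self_adjoint (hess_mx p) M.
  by rewrite /self_adjoint -hM -hess_mxT hM trmx_mul hess_mxT map_trmx.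
have [r rM] := mx_root d0 uM; have := self_adjoint_horner r aM.
move: (horner_mx M r) rM => S SM aS; exists S^T.
  rewrite unitmx_tr; apply: contraLR uM; rewrite -SM.
  rewrite !unitmxE !unitfE !negbK -(prednK d0) exprS det_mulmx => /eqP ->.
  by rewrite mul0r.
apply: (mulrn_char0_inj d0).
have := self_adjoint_lin_subst hp aS; rewrite SM -mulmxA -qM (euler_grad hq).
by move/matrixP/(_ 0 0); rewrite !mxE.
Qed.

(** * The Jacobian ideal *)

(** Taking components of a combination of the homogeneous generators only changes their
    coefficients; this makes J a homogeneous ideal. *)
Lemma pihomog_mulr (K : comNzRingType) (n d e : nat) (a q : {mpoly K[n]}) :
  q \is e.-homog ->
  pihomog mdeg d (a * q) =
    if (e <= d)%N then pihomog mdeg (d - e) a * q else 0.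
Proof.
move=> hq; elim/mpolyind: a => [|c b p _ _ IH].
  by rewrite mul0r !linear0 mul0r if_same.
have hbq : 'X_[b] * q \is (mdeg b + e).-homog.
  by apply: dhomogM => //; rewrite dhomogX.
rewrite mulrDl linearD /= {}IH -scalerAl linearZ /=.
case: leqP => [ed|de].
  rewrite linearD /= linearZ /= mulrDl -scalerAl; congr (_ *: _ + _).
  rewrite pihomogX /= -(eqn_add2r e) subnK //.
  case: eqP => [<-|/eqP bd]; first exact: pihomog_dE.
  by rewrite mul0r (pihomog_ne0 bd).
rewrite addr0 (pihomog_ne0 _ hbq) ?scaler0 //.
by rewrite gtn_eqF // (leq_trans de) // leq_addl.
Qed.

Section Jacobian.
Variables (R : realType) (n m : nat) (Q : Xform R n m).
Local Notation C := R[i].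
Local Notation J := (jacobian_ideal Q).
Local Notation Hess := (hessian Q).
Local Notation N := (n * (m - 2))%N.

Lemma jacobianP p :
  reflect (exists a : 'I_n -> {mpoly C[n]}, p = \sum_j a j * Q^`M(j)) (p \in J).
Proof. exact: asboolP. Qed.

Lemma jacobianZ c p : p \in J -> c *: p \in J.
Proof. by rewrite -mul_mpolyC; apply: idealMr. Qed.

Lemma jacobian_lin (a : C) u v : u \in J -> v \in J -> a *: u + v \in J.
Proof. by move=> uJ vJ; apply: rpredD => //; apply: jacobianZ. Qed.

Lemma Xform_deg : m = m.-2.+2.
Proof. by have := Xdeg Q; case: m => [|[|]]. Qed.

Lemma dhomog_grad j : Q^`M(j) \is m.-1.-homog.
Proof. by apply: dhomog_mderiv; rewrite prednK ?Xhomog // Xform_deg. Qed.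

Lemma dhomog_hessian : Hess \is N.-homog.
Proof.
rewrite /hessian; apply: rpred_sum => s _; rewrite rpredMsign.
have -> : N = (\sum_(i < n) (m - 2))%N by rewrite sum_nat_const card_ord.
apply: (big_ind2 (fun (q : {mpoly C[n]}) (e : nat) => q \is e.-homog)).
- exact: dhomog1.
- by move=> q e r f; apply: dhomogM.
move=> i _; rewrite mxE !dhomog_mderiv // subn2.
by rewrite -Xform_deg Xhomog.
Qed.

Lemma jacobian_coef0 p : p \in J -> p@_0 = 0.
Proof.
case/jacobianP=> a ->; rewrite raddf_sum /= big1 // => j _.
rewrite rmorphM /= (dhomog_nemf_coeff (dhomog_grad j)) ?mulr0 //=.
by rewrite mdeg0 Xform_deg.
Qed.

Lemma mderiv_jacobian j : Q^`M(j) \in J.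
Proof.
apply/jacobianP; exists (fun k => (k == j)%:R).
rewrite (bigD1 j) //= eqxx mul1r big1 ?addr0 // => k /negPf ->.
by rewrite mul0r.
Qed.

Lemma jacobian_pihomog d p : p \in J -> pihomog mdeg d p \in J.
Proof.
case/jacobianP=> a ->; rewrite linear_sum; apply: rpred_sum => j _ /=.
rewrite (pihomog_mulr _ _ (dhomog_grad j)); case: ifP => _; last exact: rpred0.
exact/idealMr/mderiv_jacobian.
Qed.

(** The generators have degree m-1, so in that degree only the constant terms of the coefficients
    survive. *)
Lemma jacobian_lowest_degree p : p \is m.-1.-homog -> p \in J ->
  exists c : 'rV[C]_n, p = \sum_j c 0 j *: Q^`M(j).
Proof.
move=> hp /jacobianP[a pE]; exists (\row_j (a j)@_0).
rewrite -[LHS](pihomog_dE hp) pE linear_sum; apply: eq_bigr => j _ /=.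
rewrite (pihomog_mulr _ _ (dhomog_grad j)) leqnn subnn mxE -mul_mpolyC.
congr (_ * _); rewrite (dhomog0_const (pihomogP mdeg 0 _)); congr _%:MP.
rewrite [in RHS](mpolyE (a j)) [in LHS]/pihomog !raddf_sum /=.
rewrite [in RHS]big_mkcond [in LHS]big_mkcond /=.
apply: eq_bigr => b _; rewrite linearZ /= mcoeffX mdeg_eq0.
by case: eqP => // _; rewrite mulr0.
Qed.

(** Differentiating the relation by z_k gives sum_j v_j Q_jk = 0. At the point v the left side is
    (m-1) Q_k(v) by Euler, so v is a common zero of the partials. *)
Lemma partials_free (v : 'rV[C]_n) : \sum_j v 0 j *: Q^`M(j) = 0 -> v = 0.
Proof.
move=> vQ; apply/eqP; apply/negPn/negP => v0; apply: (@Xdisc _ _ _ Q).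
exists v; split=> // k.
have m1 : (m.-1%:R : C) != 0 by rewrite Xform_deg pnatr_eq0.
apply: (mulfI m1); rewrite mulr0 mulr_natl -mevalMn.
rewrite -(euler_formula (dhomog_grad k)) raddf_sum /=.
have vQk : \sum_j v 0 j *: Q^`M(j)^`M(k) = 0.
  have /esym := congr1 (mderiv k) vQ; rewrite mderiv0 => {2}->.
  by rewrite (linear_sum (mderiv k)); apply: eq_bigr => j _; rewrite -mderivZ.
rewrite -[RHS](meval0 (v 0)) -vQk raddf_sum /=; apply: eq_bigr => j _.
by rewrite mevalM mevalXU mevalZ mderiv_comm.
Qed.

Lemma milnor_class_eq p q :
  milnor_class Q p = milnor_class Q q <-> p - q \in J.
Proof.
rewrite Quotient.idealrBE; split=> [pq|/eqP //].
by apply/eqP.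
Qed.

Lemma milnor_class_eq0 p : milnor_class Q p = 0 <-> p \in J.
Proof. by rewrite -(rmorph0 (milnor_class Q)) milnor_class_eq subr0. Qed.

Lemma milnor_class_surj x : exists p, x = milnor_class Q p.
Proof. by exists (repr x); rewrite /milnor_class reprK. Qed.

Lemma milnor_classZ c p : milnor_class Q (c *: p) = c *: milnor_class Q p.
Proof. by rewrite -mul_mpolyC rmorphM. Qed.

End Jacobian.

(** * Duality in the Milnor algebra *)

Section AssociatedForm.
Variables (R : realType) (n m : nat) (Q : Xform R n m) (F : {mpoly R[i][n]}).
Hypothesis QF : is_associated_form Q F.
Local Notation C := R[i].
Local Notation J := (jacobian_ideal Q).
Local Notation Hess := (hessian Q).
Local Notation N := (n * (m - 2))%N.

Lemma milnor_class_lform (z : 'rV[C]_n) :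
  \sum_j z 0 j *: milnor_class Q 'X_j = milnor_class Q (lform z).
Proof.
rewrite /lform rmorph_sum /=; apply: eq_bigr => j _.
by rewrite milnor_classZ.
Qed.

Lemma in_maximal_ideal p : p@_0 = 0 -> milnor_class Q p \in maximal_ideal Q.
Proof.
move=> p0; apply/asboolP => -[y]; have [r ->] := milnor_class_surj y.
rewrite -rmorphM -(rmorph1 (milnor_class Q)) /= milnor_class_eq.
move/jacobian_coef0; rewrite raddfB /= rmorphM /= p0 mulr0 mcoeff1 eqxx.
by rewrite sub0r => /eqP; rewrite oppr_eq0 oner_eq0.
Qed.

Lemma mcoeffXU0 (i : 'I_n) : ('X_i : {mpoly C[n]})@_0 = 0.
Proof. by rewrite mcoeffX mnm1_eq0. Qed.

Lemma socle_mulX p i : milnor_class Q p \in socle Q -> p * 'X_i \in J.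
Proof.
case/andP=> _ /asboolP /(_ _ (in_maximal_ideal (mcoeffXU0 i))).
by rewrite -rmorphM /= milnor_class_eq0.
Qed.

Lemma lform_powerX_jacobian z i : lform z ^+ N * 'X_i \in J.
Proof.
apply: socle_mulX; have [_ [omega [_ _ /(_ z)[s sE _]]]] := QF.
by rewrite rmorphXn /= -milnor_class_lform -sE socle_valP.
Qed.

Lemma socle_hessian (omega : {linear socle_type Q -> C^o})
    (e0 s : socle_type Q) :
  bijective omega -> socle_val e0 = milnor_class Q Hess -> omega e0 = 1 ->
  socle_val s = milnor_class Q (omega s *: Hess).
Proof.
move=> bij_omega e0E omega1; rewrite milnor_classZ -e0E.
have {1}-> : s = omega s *: e0; last by [].
apply: (bij_inj bij_omega); rewrite linearZ /= omega1.
by rewrite -[RHS]/(omega s * 1) mulr1.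
Qed.

(** Together with [hessian_notin_jacobian], this turns values of [F] into congruences modulo J and
    back. *)
Lemma lform_power_hessian z :
  lform z ^+ N - F.@[fun j => z 0 j] *: Hess \in J.
Proof.
have [_ [omega [bij_omega [e0 e0E omega1] /(_ z)[s sE ->]]]] := QF.
apply/milnor_class_eq; rewrite rmorphXn /= -milnor_class_lform -sE.
exact: (socle_hessian s bij_omega e0E omega1).
Qed.

Lemma hessian_notin_jacobian : Hess \notin J.
Proof.
have [_ [omega [_ [e0 e0E omega1] _]]] := QF.
apply/negP => /milnor_class_eq0; rewrite -e0E => e00.
have e0_0 : e0 = 0 by apply: val_inj.
by move: omega1; rewrite e0_0 linear0 => /eqP; rewrite eq_sym oner_eq0.
Qed.

(** N-th powers of linear forms lie in the socle, so their products with a variable lie in J; these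
    span degree N+1 by polarisation and Euler. Higher degrees follow through Euler's formula. *)
Lemma jacobian_high_degree e p : p \is (N + e.+1).-homog -> p \in J.
Proof.
have of_partials d q : q \is d.+1.-homog ->
    (forall i, q^`M(i) * 'X_i \in J) -> q \in J.
  move=> hq Jq; have d0 : (d.+1%:R : C) != 0 by rewrite pnatr_eq0.
  rewrite -[q]scale1r -(mulVf d0) -scalerA scaler_nat -(euler_formula hq).
  by apply: jacobianZ; apply: rpred_sum => i _; rewrite mulrC.
elim: e p => [|e IH] p hp; rewrite addnS in hp;
  apply: (of_partials _ _ hp) => i.
  rewrite addn0 in hp; have hpi := dhomog_mderiv i hp.
  apply: (@lform_powers_mul_span _ _ (fun u => u \in J) _ _ N) hpi.
  - exact: rpred0.
  - exact: jacobian_lin.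
  - by move=> z; apply: lform_powerX_jacobian.
by rewrite mulrC; apply/idealMr/IH/dhomog_mderiv.
Qed.

Definition order_ge (d : nat) (p : {mpoly C[n]}) :=
  forall a, a \in msupp p -> (d <= mdeg a)%N.

Lemma order_geM d e p q :
  order_ge d p -> order_ge e q -> order_ge (d + e) (p * q).
Proof.
move=> hp hq a /msuppM_le /allpairsP[[b c] /= [/hp bd /hq ce ->]].
by rewrite mdegD leq_add.
Qed.

Lemma order_ge1 p : p@_0 = 0 -> order_ge 1 p.
Proof.
move=> p0 a; rewrite lt0n mdeg_eq0; apply: contraTneq => ->.
by rewrite mcoeff_msupp p0 eqxx.
Qed.

Lemma order_ge_jacobian p : order_ge N.+1 p -> p \in J.
Proof.
move=> hp; rewrite [p]mpolyE big_seq; apply: rpred_sum => a /hp aN.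
apply: jacobianZ; apply: (@jacobian_high_degree (mdeg a - N.+1)).
by rewrite addnS -addSn subnKC // dhomogX.
Qed.

(* Descending induction on the order of q, starting from N+1, shows that every q
   is a multiple of r modulo J: with c = r(0), c q = r q - (r - c) q. *)
Lemma unit_modulo_jacobian r : r@_0 != 0 -> exists t, t * r - 1 \in J.
Proof.
set c := r@_0 => r0.
suff H k q : order_ge (N.+1 - k) q -> exists t, t * r - q \in J.
  by apply: (H N.+1); rewrite subnn.
elim: k q => [|k IH] q hq.
  exists 0; rewrite mul0r sub0r rpredN; apply: order_ge_jacobian.
  by rewrite subn0 in hq.
pose r' := r - c%:MP.
have hr' : order_ge 1 r'.
  by apply: order_ge1; rewrite raddfB /= mcoeffC eqxx mulr1 subrr.
have /IH[t tJ] : order_ge (N.+1 - k) (r' * q).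
  move=> a /(order_geM hr' hq); apply: leq_trans; rewrite subnS; lia.
exists (c^-1 *: (q - t)).
suff -> : c^-1 *: (q - t) * r - q = - c^-1 *: (t * r - r' * q).
  exact: jacobianZ.
rewrite -{2}[q]scale1r -(mulVf r0) -scalerA -scalerAl -scalerBr scaleNr.
by rewrite -scalerN; congr (_ *: _); rewrite /r' -mul_mpolyC; ring.
Qed.

(** By [unit_modulo_jacobian], non-invertible classes come from polynomials without constant term,
    and each monomial of such a polynomial contains a variable. So being killed by the variables
    suffices for the socle. *)
Lemma socle_of_mulX p :
  p@_0 = 0 -> (forall i, 'X_i * p \in J) -> exists c, p - c *: Hess \in J.
Proof.
move=> p0 pX; suff sp : milnor_class Q p \in socle Q.
  have [_ [omega [bij_omega [e0 e0E omega1] _]]] := QF.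
  exists (omega (MkSocle sp)); apply/milnor_class_eq.
  exact: (socle_hessian (MkSocle sp) bij_omega e0E omega1).
apply/andP; split; first exact: in_maximal_ideal.
apply/asboolP => y; have [r ->] := milnor_class_surj y => /asboolP ry.
have r0 : r@_0 = 0.
  apply/eqP/negPn/negP => /unit_modulo_jacobian[t tr]; case: ry.
  exists (milnor_class Q t); rewrite -rmorphM -(rmorph1 (milnor_class Q)).
  exact/milnor_class_eq.
rewrite -rmorphM; apply/milnor_class_eq0; rewrite [r]mpolyE big_seq mulr_sumr.
apply: rpred_sum => a /(order_ge1 r0); rewrite lt0n mdeg_eq0 => a0.
have [i ai] : exists i, a i != 0%N.
  apply/existsP; apply: contraNT a0 => /existsPn a0.
  by apply/eqP/mnmP => i; rewrite mnm0E; apply/eqP/negPn/a0.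
rewrite -scalerAr; apply: jacobianZ.
rewrite -(submK (m := U_(i)%MM) (m' := a)) ?lep1mP //.
by rewrite mpolyXD mulrC -mulrA idealMr.
Qed.

(** Gorenstein duality between degrees d and N-d, by induction on the codegree [k]: every X_i p lies
    in J, so p is a multiple of the Hessian modulo J. *)
Lemma jacobian_nondegenerate k d p :
  (0 < d)%N -> (d + k)%N = N -> p \is d.-homog ->
  (forall q, q \is k.-homog -> p * q \in J) -> p \in J.
Proof.
elim: k d p => [|k IH] d p d0 dk hp pJ.
  by rewrite -[p]mulr1; apply: pJ; apply: dhomog1.
have [|i|c pc] := @socle_of_mulX p _ _.
- apply: (dhomog_nemf_coeff hp); rewrite /= mdeg0; by case: d d0 {dk hp}.
- apply: (IH d.+1); rewrite ?addSnnS //.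
    by rewrite -add1n; apply: dhomogM => //; apply: dhomogXU.
  move=> q hq; rewrite [_ * p]mulrC -mulrA; apply: pJ.
  by rewrite -add1n; apply: dhomogM => //; apply: dhomogXU.
(* The Hessian has degree N > d, so the component of degree d of this congruence is p alone. *)
have := jacobian_pihomog d pc; rewrite linearB linearZ /= (pihomog_dE hp).
rewrite (pihomog_ne0 _ (dhomog_hessian Q)) ?scaler0 ?subr0 //.
by rewrite -dk gtn_eqF // addnS ltnS leq_addr.
Qed.

End AssociatedForm.

(** * Linear equivalence *)

Section LinearEquivalence.
Variables (R : realType) (n : nat).
Local Notation C := R[i].
Implicit Types (P Q : {mpoly C[n]}) (A B : 'M[C]_n).

Lemma form_act_lin_subst A Q : form_act A Q = lin_subst (invmx A) Q.
Proof.
rewrite /form_act; move: (invmx A) => B.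
suff -> : [tuple ((\row_k 'X_k : 'rV[{mpoly C[n]}]_n) *m (B^T)%:CM) 0 j | j < n]
        = [tuple \sum_k B j k *: 'X_k | j < n] by [].
apply: eq_mktuple => j; rewrite mxE; apply: eq_bigr => k _.
by rewrite !mxE mulrC mul_mpolyC.
Qed.

Lemma linearly_equivalentP P Q :
  linearly_equivalent P Q <-> exists2 B, B \in unitmx & Q = lin_subst B P.
Proof.
split=> [[A uA ->]|[B uB ->]].
  by exists (invmx A); [rewrite unitmx_inv | rewrite form_act_lin_subst].
exists (invmx B); first by rewrite unitmx_inv.
by rewrite form_act_lin_subst invmxK.
Qed.

Lemma lin_substK B : B \in unitmx -> cancel (lin_subst B) (lin_subst (invmx B)).
Proof. by move=> uB p; rewrite lin_subst_comp mulmxV // lin_subst1. Qed.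

Lemma lin_substVK B :
  B \in unitmx -> cancel (lin_subst (invmx B)) (lin_subst B).
Proof. by move=> uB p; rewrite lin_subst_comp mulVmx // lin_subst1. Qed.

Lemma lin_subst_scalar (a : C) d P :
  P \is d.-homog -> lin_subst a%:M P = a ^+ d *: P.
Proof.
move=> hP; apply/eqP; rewrite -subr_eq0; apply/eqP.
apply: (@dhomog_meval_eq0 _ _ d) => [|z].
  by rewrite rpredB ?rpredZ ?dhomog_lin_subst.
rewrite mevalB meval_lin_subst mevalZ tr_scalar_mx mul_mx_scalar.
rewrite (mpolyE P) !raddf_sum /= mulr_sumr -sumrB big_seq big1 // => b bP.
rewrite !mevalZ !mevalX mulrCA -mulrBr -(dhomog_mf hP bP) /= mdegE -prodrXr.
rewrite -big_split /= (eq_bigr (fun i => a ^+ b i * z 0 i ^+ b i)).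
  by rewrite subrr mulr0.
by move=> i _; rewrite mxE exprMn.
Qed.

End LinearEquivalence.

(** * Transport of the Jacobian ideal and of the associated form *)

Section Main.
Variables (R : realType) (n m : nat).
Local Notation C := R[i].
Local Notation N := (n * (m - 2))%N.
Implicit Types (Q : Xform R n m) (F : {mpoly C[n]}).

Lemma jacobian_lin_subst Q Q' B p : B \in unitmx ->
  Q' = lin_subst B Q :> {mpoly C[n]} ->
  p \in jacobian_ideal Q -> lin_subst B p \in jacobian_ideal Q'.
Proof.
move=> uB QB /jacobianP[a ->]; rewrite rmorph_sum; apply: rpred_sum => j _ /=.
rewrite rmorphM /=; apply: idealMr; apply/jacobianP.
have : map_mx (lin_subst B) (grad Q) = (invmx B^T)%:CM *m grad Q'.
  rewrite QB grad_lin_subst mulmxA -map_mxM mulVmx ?unitmx_tr //.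
  by rewrite map_mx1 mul1mx.
move: (invmx B^T) => A /matrixP/(_ j 0); rewrite !mxE => ->.
by exists (fun k => (A j k)%:MP); apply: eq_bigr => k _; rewrite !mxE.
Qed.

Lemma hessian_lin_subst (B : 'M[C]_n) (p : {mpoly C[n]}) :
  hessian (lin_subst B p) = \det B ^+ 2 *: lin_subst B (hessian p).
Proof.
rewrite -[LHS]/(\det (hess_mx _)) hess_lin_subst !det_mulmx.
by rewrite !det_map_mx det_tr mulrAC -expr2 -rmorphXn mul_mpolyC.
Qed.

Lemma associated_form_equivalent Q Q' F F' : (0 < N)%N ->
  is_associated_form Q F -> is_associated_form Q' F' ->
  linearly_equivalent Q Q' -> linearly_equivalent F F'.
Proof.
move=> N0 QF QF' /linearly_equivalentP[B uB QB]; apply/linearly_equivalentP.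
have [hF _] := QF; have [hF' _] := QF'.
pose c := \det B ^- 2.
have detB0 : \det B ^+ 2 != 0 by rewrite expf_neq0 // -unitfE -unitmxE.
(* Substituting in the congruence for z gives a second expression of ([lform (z *m B)])^N modulo
   J(Q'); the two multiples of Hess(Q') must agree. *)
have val (z : 'rV[C]_n) : F'.@[fun j => (z *m B) 0 j] = c * F.@[fun j => z 0 j].
  have := jacobian_lin_subst uB QB (lform_power_hessian QF z).
  rewrite rmorphB rmorphXn /= lin_substZ lin_subst_lform.
  have -> : lin_subst B (hessian Q) = c *: hessian Q'.
    rewrite QB (hessian_lin_subst B Q) scalerA (mulVf detB0).
    exact/esym/scale1r.
  have := lform_power_hessian QF' (z *m B).
  move=> /rpredB /[apply]; rewrite opprB addrC subrKA scalerA -scalerBl.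
  move=> FJ; apply/eqP; rewrite mulrC eq_sym -subr_eq0; apply: contraT => nz.
  have := hessian_notin_jacobian QF'.
  by rewrite -[hessian Q']scale1r -(mulVf nz) -scalerA jacobianZ.
(* As F has degree N > 0, an N-th root of c absorbs this factor into a scalar substitution. *)
have [a ac] : exists a : C, a ^+ N = c by exists (N.-root c); apply: rootCK.
have a0 : a != 0.
  apply: contraTneq detB0 => a0; rewrite -invr_eq0 -/c -ac a0 expr0n gtn_eqF //.
  by rewrite eqxx.
have FE : lin_subst B^T F' = lin_subst a%:M F.
  rewrite (lin_subst_scalar _ hF) ac; apply/eqP; rewrite -subr_eq0; apply/eqP.
  apply: (@dhomog_meval_eq0 _ _ N) => [|z].
    by rewrite rpredB ?rpredZ ?dhomog_lin_subst.
  by rewrite mevalB meval_lin_subst mevalZ trmxK val subrr.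
exists (a%:M *m invmx B^T).
  rewrite unitmx_mul unitmx_inv unitmx_tr uB andbT unitmxE det_scalar.
  by rewrite unitfE expf_neq0.
have uBT : B^T \in unitmx by rewrite unitmx_tr.
by rewrite -lin_subst_comp -FE (lin_substK uBT F').
Qed.

(** By duality it is enough to test the image of [p] against forms of complementary degree, which
    reduces the claim to degree N, where F and F' control membership. *)
Lemma jacobian_of_associated_form Q Q' F F' B d p :
  is_associated_form Q F -> is_associated_form Q' F' ->
  B \in unitmx -> F' = lin_subst B F ->
  (0 < d <= N)%N -> p \is d.-homog -> p \in jacobian_ideal Q' ->
  lin_subst B^T p \in jacobian_ideal Q.
Proof.
move=> QF QF' uB FB /andP[d0 dN] hp pJ.
have uBT : B^T \in unitmx by rewrite unitmx_tr.
apply: (@jacobian_nondegenerate _ _ _ _ _ QF (N - d) d).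
- by [].
- by rewrite subnKC.
- exact: dhomog_lin_subst.
move=> q hq; rewrite -(lin_substVK uBT q) -rmorphM /=.
set q' := lin_subst _ q.
have hpq : p * q' \is N.-homog.
  by rewrite -(subnKC dN); apply: dhomogM => //; apply: dhomog_lin_subst.
(* The same [c] must serve on both sides. For N-th powers of linear forms it is F'(z) = F(z B^T),
   and the condition is linear in u. *)
pose S u := exists c, u - c *: hessian Q' \in jacobian_ideal Q' /\
                      lin_subst B^T u - c *: hessian Q \in jacobian_ideal Q.
have [||z|c [cJ' cJ]] := @lform_powers_span _ _ N S _ _ _ _ hpq.
- exists 0; split; first by rewrite scale0r subr0 rpred0.
  by rewrite scale0r subr0 rmorph0 rpred0.
- move=> a u v [c [uc uc']] [e [ve ve']]; exists (a * c + e).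
  split; last rewrite (rmorphD (lin_subst B^T)) /= lin_substZ.
    have := jacobian_lin a uc ve.
    by rewrite scalerBr addrACA scalerA -opprD -scalerDl.
  have := jacobian_lin a uc' ve'.
  by rewrite scalerBr addrACA scalerA -opprD -scalerDl.
- exists F'.@[fun j => z 0 j]; split; first exact: lform_power_hessian.
  rewrite rmorphXn /= lin_subst_lform FB meval_lin_subst.
  exact: lform_power_hessian.
(* The product p q' lies in J(Q'), hence so does c Hess(Q'), while Hess(Q') does not. *)
have c0 : c = 0.
  apply: contraTeq (hessian_notin_jacobian QF') => c0; apply/negPn.
  have := rpredB (idealMr q' pJ) cJ'; rewrite (mulrC q') subKr.
  by move=> /(jacobianZ c^-1); rewrite scalerA (mulVf c0) scale1r.
by move: cJ; rewrite c0 scale0r subr0.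
Qed.

End Main.

Theorem theorem3p1 (R : realType) (n m : nat) (hn : (2 <= n)%N) (hm : (3 <= m)%N)
    (Q Q' : Xform R n m) (F F' : {mpoly R[i][n]})
    (hF : is_associated_form Q F) (hF' : is_associated_form Q' F') :
  linearly_equivalent Q Q' <-> linearly_equivalent F F'.
Proof.
split.
  apply: associated_form_equivalent hF hF'.
  by rewrite muln_gt0 subn_gt0 hm ltnW.
case: n hn Q Q' F F' hF hF' => [|n] hn; first by discriminate hn.
move=> Q Q' F F' hF hF'.
case/linearly_equivalentP=> B uB FB.
have uBT : B^T \in unitmx by rewrite unitmx_tr.
(* The partials must lie in the range of degrees controlled by F: with at least two variables and m
   >= 3, N >= 2(m-2) >= m-1. *)
have m1N : (0 < m.-1 <= n.+1 * (m - 2))%N.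
  case: m hm {Q Q' hF hF'} => [|[|[|k]]] // _; rewrite !subSS subn0 /=.
  by apply: leq_trans (leq_mul hn (leqnn _)); rewrite mul2n -addnn; lia.
have /fin_all_exists[c cE] j : exists c : 'rV[R[i]]_n.+1,
    lin_subst B^T Q'^`M(j) = \sum_k c 0 k *: Q^`M(k).
  have hj := dhomog_grad Q' j; apply: jacobian_lowest_degree.
    exact: dhomog_lin_subst.
  apply: (jacobian_of_associated_form hF hF' uB FB m1N hj).
  exact: mderiv_jacobian.
pose M : 'M[R[i]]_n.+1 := \matrix_(j, k) c j 0 k.
(* A left kernel vector of [M] gives a combination of the partials of Q' that the injective
   substitution sends to 0, against their independence. *)
have uM : M \in unitmx.
  rewrite unitmxE unitfE; apply/det0P => -[v /negP v0 vM]; case: v0; apply/eqP.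
  apply: (@partials_free _ _ _ Q'); apply: (can_inj (lin_substK uBT)).
  rewrite rmorph0 rmorph_sum /=.
  under eq_bigr => j _ do rewrite lin_substZ cE scaler_sumr.
  rewrite exchange_big big1 //= => k _.
  move/rowP/(_ k): vM; rewrite !mxE => vMk.
  under eq_bigr => j _ do rewrite scalerA.
  rewrite -scaler_suml (eq_bigr (fun j => v 0 j * M j k)) ?vMk ?scale0r //.
  by move=> j _; rewrite mxE.
(* The factor [B] is the chain rule for the substitution by B^T. *)
have gradE : grad (lin_subst B^T Q') = (B *m M)%:CM *m grad Q.
  rewrite grad_lin_subst trmxK map_mxM -mulmxA; congr (_ *m _).
  apply/matrixP => j i; rewrite !mxE cE; apply: eq_bigr => k _.
  by rewrite !mxE mul_mpolyC.
have [||||S uS QS] := @lin_subst_of_grad R[i] n m Q (lin_subst B^T Q')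
  (B *m M) _ _ _ _ gradE.
- exact: leq_trans hm.
- exact: Xhomog.
- exact/dhomog_lin_subst/Xhomog.
- by rewrite unitmx_mul uB.
apply/linearly_equivalentP; exists (S *m invmx B^T).
  by rewrite unitmx_mul uS unitmx_inv.
by rewrite -lin_subst_comp -QS lin_substK.
Qed.
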